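(* Recipes 1 and 2 are correct, that is: (Recipe 1) Let $p\in\mathbb{Z}^n$ have positive components, let $u$ be a vector each of whose components is a positive integer or $+\infty$, let $r\in\mathbb{Z}^n$, and let $k$ be an integer with $0\le k<pu$. If $M$ is a positive integer and $\beta_1,\beta_2$ are such that $pM+r>0$ (componentwise) and $$\max(r,p,k,u)+kM<\beta_1\le\beta_2<\min(r,p,k+1,u)+(k+1)M,$$ then, with $a=pM+r$, the infeasibility of $$\beta_1\le ax\le\beta_2,\quad 0\le x\le u,\quad x\in\mathbb{Z}^n$$ is proven by $px\le k\,\vee\,px\ge k+1$. (Recipe 2) Let $p\in\mathbb{Z}^n$ have positive components and let $r\in\mathbb{Z}^n$, where $p$ is not a multiple of $r$ and $r_1/p_1\le\dots\le r_n/p_n$; let $k$ be a nonnegative integer. If $M$ and $\beta$ are positive integers such that $pM+r>0$ (componentwise) and $$0\le k(M+r_n/p_n)<\beta<(k+1)(M+r_1/p_1),$$ then, with $a=pM+r$, the infeasibility of $$ax=\beta,\quad x\ge0,\quad x\in\mathbb{Z}^n$$ is proven by $px\le k\,\vee\,px\ge k+1$.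
   Context: Products such as $px$, $ax$, $pu$ are inner products; $pu=+\infty$ if some $u_i=+\infty$. For vectors $f,p,u$ and a number $\ell$, $$\max(f,p,\ell,u)=\max\{fx : px\le\ell,\ 0\le x\le u\},\qquad \min(f,p,\ell,u)=\min\{fx : px\ge\ell,\ 0\le x\le u\},$$ where $x$ ranges over real vectors. The LP relaxation of an integer program is obtained by dropping integrality. The infeasibility of an integer program is proven by $px \le k \vee px \ge k+1$ if both $\{x : px \le k\}$ and $\{x : px \ge k+1\}$ have empty intersection with the feasible set of its LP relaxation. *)

(* Defs.v *)
From HB Require Import structures.
From mathcomp Require Import all_boot all_order all_algebra.
From mathcomp Require Import all_classical all_reals ereal.

Set Implicit Arguments.
Unset Strict Implicit.
Unset Printing Implicit Defensive.

Import Order.TTheory GRing.Theory Num.Theory.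
Local Open Scope classical_set_scope.
Local Open Scope ring_scope.

Section Vectors.
Variables (R : realType) (n : nat).

Definition realv (v : 'rV[int]_n) : 'rV[R]_n := map_mx intr v.

Definition dot (a x : 'rV[R]_n) : R := \sum_i a 0 i * x 0 i.

(* For p > 0 and u > -oo this is +oo as soon as some u_i = +oo. *)
Definition edot (p : 'rV[R]_n) (u : 'rV[\bar R]_n) : \bar R :=
  (\sum_i (p 0%R i)%:E * u 0%R i)%E.

Definition in_box (u : 'rV[\bar R]_n) (x : 'rV[R]_n) : Prop :=
  forall i, 0 <= x 0 i /\ ((x 0%R i)%:E <= u 0%R i)%E.

End Vectors.

Section LinearPrograms.
Variables (R : realType) (n : nat).
Implicit Types (f p x : 'rV[R]_n) (l : R) (u : 'rV[\bar R]_n).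

Definition max_values f p l u : set R :=
  [set dot f x | x in [set x | dot p x <= l /\ in_box u x]].

Definition min_values f p l u : set R :=
  [set dot f x | x in [set x | l <= dot p x /\ in_box u x]].

(* Optimal values live in the extended reals, so that an unbounded program has
   value +oo (max) or -oo (min); when the optimum is attained they are the
   usual maximum and minimum (lp_maxE and lp_minE). *)
Definition lp_max f p l u : \bar R := ereal_sup (EFin @` max_values f p l u).

Definition lp_min f p l u : \bar R := ereal_inf (EFin @` min_values f p l u).

Lemma lp_maxE f p l u v :
  max_values f p l u v -> ubound (max_values f p l u) v ->
  lp_max f p l u = v%:E.
Proof.
move=> Sv ubv; apply/eqP; rewrite eq_le; apply/andP; split.
  by apply: ge_ereal_sup => _ [w Sw <-]; rewrite lee_fin; exact: ubv.
by apply: ereal_sup_ubound; exists v.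
Qed.

Lemma lp_minE f p l u v :
  min_values f p l u v -> lbound (min_values f p l u) v ->
  lp_min f p l u = v%:E.
Proof.
move=> Sv lbv; apply/eqP; rewrite eq_le; apply/andP; split.
  by apply: ereal_inf_lbound; exists v.
by apply: le_ereal_inf_tmp => _ [w Sw <-]; rewrite lee_fin; exact: lbv.
Qed.

End LinearPrograms.

(* An integer program is given by its constraints on real vectors; the
   integrality of x is implicit and enters in ip_feasible only. *)
Record int_program (R : realType) (n : nat) :=
  IntProgram { constraints : set 'rV[R]_n }.

Section IntegerPrograms.
Variables (R : realType) (n : nat).
Implicit Types (P : int_program R n) (p : 'rV[int]_n) (k : int).

Definition ip_feasible P : set 'rV[int]_n :=
  [set x | constraints P (realv R x)].

Definition lp_relaxation P : set 'rV[R]_n := constraints P.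

Definition infeasibility_proven_by P p k : Prop :=
  [set x | dot (realv R p) x <= k%:~R] `&` lp_relaxation P = set0 /\
  [set x | (k + 1)%:~R <= dot (realv R p) x] `&` lp_relaxation P = set0.

Lemma infeasibility_proven_by_sound P p k :
  infeasibility_proven_by P p k -> ip_feasible P = set0.
Proof.
move=> [lo hi]; rewrite -subset0 => x Px.
have dotE : dot (realv R p) (realv R x) = (\sum_i p 0 i * x 0 i)%:~R.
  by rewrite /dot rmorph_sum; apply: eq_bigr => i _; rewrite !mxE rmorphM.
have [le_k|lt_k] := leP (\sum_i p 0 i * x 0 i) k.
  by have : set0 (realv R x) by rewrite -lo; split; rewrite //= dotE ler_int.
by have : set0 (realv R x) by rewrite -hi; split; rewrite //= dotE ler_int lezD1.
Qed.

Definition interval_knapsack (a : 'rV[int]_n) (b1 b2 : R) (u : 'rV[\bar R]_n) :=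
  IntProgram [set x : 'rV[R]_n |
    b1 <= dot (realv R a) x <= b2 /\ in_box u x].

Definition equality_knapsack (a : 'rV[int]_n) (b : int) :=
  IntProgram [set x : 'rV[R]_n |
    dot (realv R a) x = b%:~R /\ forall i, 0 <= x 0 i].

End IntegerPrograms.

(* Main.v *)
Require Import Defs.
From HB Require Import structures.
From mathcomp Require Import all_boot all_order all_algebra.
From mathcomp Require Import all_classical all_reals ereal.

Set Implicit Arguments.
Unset Strict Implicit.
Unset Printing Implicit Defensive.

Import Order.TTheory GRing.Theory Num.Theory.
Local Open Scope ring_scope.

(** Write a = M p + r, so that ax = M(px) + rx for every real x.  Both recipes
    say that ax is too small for the right-hand side when px <= k, and too large
    when px >= k + 1.

    In the first recipe the two terms of ax are bounded separately: if px <= k,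
    then M(px) <= kM, and rx is at most the maximum of r over the points of the
    box with px <= k; the case px >= k + 1 is symmetric.

    In the second recipe there is no upper bound on x, and the comparison is
    made coordinate by coordinate: a_i = (M + r_i/p_i) p_i lies between
    (M + r_1/p_1) p_i and (M + r_n/p_n) p_i, and x is nonnegative, so that ax
    lies between (M + r_1/p_1) px and (M + r_n/p_n) px ([dot_le]).  As a and p
    are positive, these factors are positive and preserve the bound on px. *)

Section DotProduct.
Variables (R : realType) (n : nat).
Implicit Types a b x : 'rV[R]_n.

Lemma dotDl a b x : dot (a + b) x = dot a x + dot b x.
Proof.
by rewrite /dot -big_split; apply: eq_bigr => i _; rewrite mxE mulrDl.
Qed.

Lemma dotZl (c : R) a x : dot (c *: a) x = c * dot a x.
Proof.
by rewrite /dot mulr_sumr; apply: eq_bigr => i _; rewrite mxE mulrA.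
Qed.

Lemma dot_le a b x : (forall i, a 0 i <= b 0 i) -> (forall i, 0 <= x 0 i) ->
  dot a x <= dot b x.
Proof. by move=> le_ab x_ge0; apply: ler_sum => i _; rewrite ler_wpM2r. Qed.

Lemma realvMD (M : int) (p r : 'rV[int]_n) :
  realv R (M *: p + r) = M%:~R *: realv R p + realv R r.
Proof. by apply/rowP => i; rewrite !mxE rmorphD rmorphM. Qed.

Lemma dot_realvMD (M : int) (p r : 'rV[int]_n) x :
  dot (realv R (M *: p + r)) x
    = M%:~R * dot (realv R p) x + dot (realv R r) x.
Proof. by rewrite realvMD dotDl dotZl. Qed.

(** Where p_i > 0, this is the factorisation that makes the ratios r_i / p_i
    govern the size of ax relative to px. *)
Lemma realvMD_ratio (M : int) (p r : 'rV[int]_n) i : 0 < p 0 i ->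
  realv R (M *: p + r) 0 i
    = (M%:~R + (r 0 i)%:~R / (p 0 i)%:~R) * (p 0 i)%:~R.
Proof.
move=> p_gt0; have pN0 : (p 0 i)%:~R != 0 :> R by rewrite intr_eq0 gt_eqF.
by rewrite realvMD !mxE mulrDl divfK.
Qed.

End DotProduct.

(** The disjunction proves infeasibility as soon as the relaxation lies strictly
    inside the strip k < px < k + 1. *)
Lemma proven_by_strip (R : realType) (n : nat)
    (P : int_program R n) (p : 'rV[int]_n) (k : int) :
  (forall x, lp_relaxation P x -> k%:~R < dot (realv R p) x) ->
  (forall x, lp_relaxation P x -> dot (realv R p) x < (k + 1)%:~R) ->
  infeasibility_proven_by P p k.
Proof.
move=> gt_k lt_k1; split; rewrite -subset0 => x [/= px Px].
- by have := gt_k x Px; rewrite ltNge px.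
- by have := lt_k1 x Px; rewrite ltNge px.
Qed.

(** Real inequalities are recovered here and in [lp_min_bound] from the
    extended-real ones: as the program is feasible (x is a witness) and c is
    finite, this also covers infinite optimal values. *)
Lemma lp_max_bound (R : realType) (n : nat) (f p x : 'rV[R]_n) (l c b : R)
    (u : 'rV[\bar R]_n) :
  dot p x <= l -> in_box u x -> (lp_max f p l u + c%:E < b%:E)%E ->
  dot f x + c < b.
Proof.
move=> px ux; rewrite -lte_fin EFinD; apply: le_lt_trans; apply: leeD => //.
by apply: ereal_sup_ubound; exists (dot f x) => //; exists x.
Qed.

Lemma lp_min_bound (R : realType) (n : nat) (f p x : 'rV[R]_n) (l c b : R)
    (u : 'rV[\bar R]_n) :
  l <= dot p x -> in_box u x -> (b%:E < lp_min f p l u + c%:E)%E ->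
  b < dot f x + c.
Proof.
move=> px ux ltb; rewrite -lte_fin EFinD; apply: (lt_le_trans ltb).
apply: leeD => //.
by apply: ereal_inf_lbound; exists (dot f x) => //; exists x.
Qed.

(** M(px) and rx are estimated independently, the latter by the optimal value of
    the linear program over the same half of the disjunction. *)
Lemma proven_by_lp_values (R : realType) (n : nat) (p r : 'rV[int]_n)
    (u : 'rV[\bar R]_n) (k M : int) (beta1 beta2 : R) :
  0 <= M ->
  (lp_max (realv R r) (realv R p) k%:~R u + ((k * M)%:~R)%:E < beta1%:E)%E ->
  (beta2%:E < lp_min (realv R r) (realv R p) (k + 1)%:~R u
              + (((k + 1) * M)%:~R)%:E)%E ->
  infeasibility_proven_by (interval_knapsack (M *: p + r) beta1 beta2 u) p k.
Proof.
move=> M_ge0 lt_beta1 gt_beta2.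
have MR_ge0 : 0 <= M%:~R :> R by rewrite ler0z.
apply: proven_by_strip => x [/andP[beta1_ax ax_beta2] ux];
  rewrite ltNge; apply/negP => px.
- have := lt_le_trans (lp_max_bound px ux lt_beta1) beta1_ax.
  by rewrite dot_realvMD addrC ltrD2r rmorphM mulrC ltNge ler_wpM2l.
- have := le_lt_trans ax_beta2 (lp_min_bound px ux gt_beta2).
  rewrite dot_realvMD [X in _ < X]addrC ltrD2r rmorphM.
  by rewrite [X in _ < X]mulrC ltNge ler_wpM2l.
Qed.

(** Coordinatewise, (M + t) p <= M p + r <= (M + s) p, so that ax lies between
    (M + t) px and (M + s) px for x >= 0.  Nonnegativity of M + s and M + t is
    what lets them multiply the two bounds on px. *)
Lemma proven_by_ratio_bounds (R : realType) (n : nat) (p r : 'rV[int]_n) (k M beta : int)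
    (s t : R) :
  (forall i, 0 < p 0 i) ->
  (forall i, (r 0 i)%:~R / (p 0 i)%:~R <= s) ->
  (forall i, t <= (r 0 i)%:~R / (p 0 i)%:~R) ->
  0 <= M%:~R + s -> 0 <= M%:~R + t ->
  k%:~R * (M%:~R + s) < beta%:~R ->
  beta%:~R < (k + 1)%:~R * (M%:~R + t) ->
  infeasibility_proven_by (equality_knapsack R (M *: p + r) beta) p k.
Proof.
move=> p_gt0 le_s ge_t Ms_ge0 Mt_ge0 lt_beta gt_beta.
have pR_ge0 i : 0 <= (p 0 i)%:~R :> R by rewrite ler0z ltW.
apply: proven_by_strip => x [ax x_ge0];
  rewrite ltNge; apply/negP => px.
- have ax_le : dot (realv R (M *: p + r)) x <= (M%:~R + s) * dot (realv R p) x.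
    rewrite -dotZl; apply: dot_le => // i.
    by rewrite realvMD_ratio // !mxE ler_wpM2r // lerD2l.
  rewrite ax in ax_le; have := lt_le_trans lt_beta ax_le.
  by rewrite mulrC ltNge ler_wpM2l.
- have ax_ge : (M%:~R + t) * dot (realv R p) x <= dot (realv R (M *: p + r)) x.
    rewrite -dotZl; apply: dot_le => // i.
    by rewrite realvMD_ratio // !mxE ler_wpM2r // lerD2l.
  rewrite ax in ax_ge; have := le_lt_trans ax_ge gt_beta.
  by rewrite [X in _ < X]mulrC ltNge ler_wpM2l.
Qed.

Theorem theorem4 (R : realType) :
  (forall (n : nat) (p r : 'rV[int]_n) (u : 'rV[\bar R]_n) (k M : int)
          (beta1 beta2 : R),
    (forall i, 0 < p 0 i) ->
    (forall i, (exists m : int, 0 < m /\ u 0 i = (m%:~R)%:E) \/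
               u 0 i = +oo%E) ->
    0 <= k ->
    ((k%:~R)%:E < edot (realv R p) u)%E ->
    0 < M ->
    (forall i, 0 < (M *: p + r) 0 i) ->
    (lp_max (realv R r) (realv R p) k%:~R u + ((k * M)%:~R)%:E
       < beta1%:E)%E ->
    beta1 <= beta2 ->
    (beta2%:E < lp_min (realv R r) (realv R p) (k + 1)%:~R u
                + (((k + 1) * M)%:~R)%:E)%E ->
    infeasibility_proven_by (interval_knapsack (M *: p + r) beta1 beta2 u) p k)
  /\
  (forall (n : nat) (p r : 'rV[int]_n.+1) (k M beta : int),
    let ratio i : R := (r 0 i)%:~R / (p 0 i)%:~R in
    (forall i, 0 < p 0 i) ->
    ~ (exists c : R, realv R p = c *: realv R r) ->
    (forall i j : 'I_n.+1, (i <= j)%N -> ratio i <= ratio j) ->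
    0 <= k ->
    0 < M ->
    0 < beta ->
    (forall i, 0 < (M *: p + r) 0 i) ->
    0 <= k%:~R * (M%:~R + ratio ord_max) ->
    k%:~R * (M%:~R + ratio ord_max) < beta%:~R ->
    beta%:~R < (k + 1)%:~R * (M%:~R + ratio ord0) ->
    infeasibility_proven_by (equality_knapsack R (M *: p + r) beta) p k).
Proof.
split=> [n p r u k M beta1 beta2 _ _ _ _ M_gt0 _ lt_beta1 _ gt_beta2|].
  by apply: proven_by_lp_values => //; exact: ltW.
move=> n p r k M beta ratio p_gt0 _ ratio_le _ _ _ a_gt0 _ lt_beta gt_beta.
(* The sign of M + r_i / p_i is that of a_i, because a_i is its multiple
   by p_i > 0. *)
have Mratio_ge0 i : 0 <= M%:~R + ratio i.
  have pR_gt0 : 0 < (p 0 i)%:~R :> R by rewrite ltr0z.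
  by rewrite -(pmulr_lge0 _ pR_gt0) -realvMD_ratio // mxE ler0z ltW.
apply: (@proven_by_ratio_bounds _ _ _ _ _ _ _ (ratio ord_max) (ratio ord0)) => // i.
- by apply: ratio_le; rewrite -ltnS.
- exact: ratio_le.
Qed.
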